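(* Let $E\subseteq\mathbb{R}$ be compact and nowhere dense. Then the following are equivalent: (1) $(\mathbb{R},<,+,E)$ is type A; (2) every $(\mathbb{R},<,+,E)$-definable subset of $\mathbb{R}$ has interior or is nowhere dense; (3) $T(E^n)$ is nowhere dense for every $n$ and every $\mathbb{Q}$-linear map $T:\mathbb{R}^n\to\mathbb{R}$; (4) the subgroup of $(\mathbb{R},+,0)$ generated by $E$ is not equal to $\mathbb{R}$.
   Context: Definability is with parameters. An expansion $\mathscr{R}$ of $(\mathbb{R},<,+)$ is type A if there is no $\mathscr{R}$-definable subset of $\mathbb{R}$ which is dense in some nonempty open interval and is either finite or admits an $\mathscr{R}$-definable order of order type $\omega$.
   Formalization: In (3), ''Q-linear map T: R^n → R'' is taken to mean a linear form with rational coefficients; for arbitrary Q-vector-space homomorphisms the equivalence fails (a Q-independent Cantor set E satisfies (4), yet some discontinuous T maps E onto R). *)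

(* Defs.v *)
From HB Require Import structures.
From mathcomp Require Import all_boot all_order all_algebra.
From mathcomp Require Import all_classical all_reals all_analysis.

Set Implicit Arguments.
Unset Strict Implicit.
Unset Printing Implicit Defensive.

Import Order.TTheory GRing.Theory Num.Theory.
Import numFieldNormedType.Exports.

Local Open Scope classical_set_scope.
Local Open Scope ring_scope.

(** * First-order definability in expansions of (R, <, +)

   Points of R^n are row vectors ['rV[R]_n].  An expansion is presented by
   relation symbols only: a function is given by its graph, and the definable
   sets are the same. *)

Record expansion (R : realType) := Expansion {
  rsym : Type;
  arity : rsym -> nat;
  interp : forall s : rsym, set 'rV[R]_(arity s)
}.

(* Variables are de Bruijn indices: [Ex] binds index 0. *)
Inductive term := Var of nat | Add of term & term.

Inductive formula (S : Type) (ar : S -> nat) :=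
| Eq of term & term
| Lt of term & term
| Rel (s : S) of 'I_(ar s) -> term
| Neg of formula ar
| Conj of formula ar & formula ar
| Ex of formula ar.

Definition env_cons (R : realType) (x : R) (e : nat -> R) : nat -> R :=
  fun i => if i is j.+1 then e j else x.

Fixpoint eval (R : realType) (e : nat -> R) (t : term) : R :=
  match t with
  | Var i => e i
  | Add t1 t2 => eval e t1 + eval e t2
  end.

Fixpoint holds (R : realType) (M : expansion R) (e : nat -> R)
    (f : formula (@arity R M)) : Prop :=
  match f with
  | Eq t1 t2 => eval e t1 = eval e t2
  | Lt t1 t2 => eval e t1 < eval e t2
  | Rel s t => interp (\row_(i < arity s) eval e (t i))
  | Neg g => ~ holds e g
  | Conj g h => holds e g /\ holds e h
  | Ex g => exists x : R, holds (env_cons x e) g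
  end.

Definition env_cat (R : realType) (n : nat) (x : 'rV[R]_n) (p : nat -> R) :
    nat -> R :=
  fun i => if insub i is Some j then x 0 j else p (i - n)%N.

(* Definability with parameters: [p] lists the parameters; a formula only
   mentions finitely many of them. *)
Definition definable (R : realType) (M : expansion R) (n : nat)
    (X : set 'rV[R]_n) : Prop :=
  exists (f : formula (@arity R M)) (p : nat -> R),
    X = [set x | holds (env_cat x p) f].

Definition definable1 (R : realType) (M : expansion R) (X : set R) : Prop :=
  definable M [set x : 'rV[R]_1 | X (x 0 0)].

Definition definable2 (R : realType) (M : expansion R) (L : R -> R -> Prop) :
    Prop :=
  definable M [set x : 'rV[R]_2 | L (x 0 0) (x 0 1)].

(* The structure (R, <, +, E). *)
Definition expand_by (R : realType) (E : set R) : expansion R :=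
  {| rsym := unit;
     arity := fun=> 1%N;
     interp := fun=> [set x : 'rV[R]_1 | E (x 0 0)] |}.

(** * Type A *)

(* [L] is the strict order; [u] is an isomorphism from (nat, <) to (X, L), so
   that [L] is automatically a linear order on [X]. *)
Definition order_type_omega (R : realType) (X : set R) (L : R -> R -> Prop) :
    Prop :=
  (forall x y, L x y -> X x /\ X y) /\
  exists u : nat -> R, set_bij setT X u /\
    forall m n : nat, L (u m) (u n) <-> (m < n)%N.

Definition omega_orderable (R : realType) (M : expansion R) (X : set R) :
    Prop :=
  finite_set X \/
  exists L : R -> R -> Prop, definable2 M L /\ order_type_omega X L.

Definition dense_in (R : realType) (I X : set R) : Prop :=
  I `<=` closure (X `&` I).

Definition somewhere_dense_in_interval (R : realType) (X : set R) : Prop :=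
  exists I : set R, [/\ is_interval I, open I, I !=set0 & dense_in I X].

Definition type_A (R : realType) (M : expansion R) : Prop :=
  ~ exists X : set R,
      [/\ definable1 M X, somewhere_dense_in_interval X & omega_orderable M X].

(** * Topology and algebra *)

Definition nowhere_dense (R : realType) (X : set R) : Prop :=
  (closure X)° = set0.

Definition cartesian_power (R : realType) (E : set R) (n : nat) :
    set 'rV[R]_n :=
  [set x | forall i, E (x 0 i)].

Arguments cartesian_power {R} E n.

(* A Q-linear map R^n -> R is a linear form with rational coefficients, i.e. a
   Q-linear map definable in (R, <, +); arbitrary homomorphisms of Q-vector
   spaces, which need not be continuous, are not meant. *)
Definition Q_linear (R : realType) (n : nat) (T : 'rV[R]_n -> R) : Prop :=
  exists q : 'I_n -> rat, forall x, T x = \sum_(i < n) ratr (q i) * x 0 i.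

Definition generated_subgroup (R : realType) (E : set R) : set R :=
  smallest (fun G : set R => zmod_closed (mem G)) E.

(* Main.v *)
Require Import Defs.
From mathcomp Require Import finmap.
From mathcomp Require Import all_boot all_order all_algebra.
From mathcomp Require Import all_classical all_reals all_analysis.
From mathcomp Require Import ring lra.
Import Order.TTheory GRing.Theory Num.Theory.
Import numFieldNormedType.Exports.
Local Open Scope classical_set_scope.
Local Open Scope ring_scope.

Set Implicit Arguments.
Unset Strict Implicit.
Unset Printing Implicit Defensive.

(** The Q-linear combinations of elements of [E] form a countable union of
   compact sets [T(E^n)].

   If every [T(E^n)] is nowhere dense, definable sets are controlled by a
   back-and-forth argument: two tuples satisfy the same formulas of bounded
   complexity as soon as finitely many compact families of affine forms
   [l(x) + g], [g] in some [T(E^n)], have the same signs at both of them. A new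
   coordinate can always be matched because, by compactness, it has nearest
   neighbours among the finitely many compact families of cut points. Hence a
   definable subset of [R] is locally constant off finitely many translates of
   sets [T(E^n)], so it has interior or is nowhere dense; and a countable set
   has no interior, so type A follows.

   If [E] generates [R], then by Baire some set of signed sums of [n] elements
   of [E] contains an interval. The points of [E] followed by a gap of length
   more than [t] form a finite set, and their union over [t > 0] is dense in
   [E]; the signed sums of such points are dense in that interval and are
   ordered in type omega, first by the largest admissible [t], then by [<].
   Conversely, an interval inside some [T(E^n)] gives, after clearing
   denominators, an interval inside the subgroup generated by [E]. *)

(** * Nowhere dense subsets of the line and Baire category *)

Lemma interior_eq0P (R : realType) (A : set R) :
  A° = set0 <-> forall x r, 0 < r -> ~ (ball x r `<=` A).
Proof.
split=> [A0 x r r0 xA|nA].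
  by have : A° x; [apply/nbhs_ballP; exists r|rewrite A0].
apply/seteqP; split=> // x /nbhs_ballP[r /= r0 xA]; exact: (nA x r).
Qed.

Lemma nowhere_denseP (R : realType) (A : set R) :
  closed A -> nowhere_dense A <-> A° = set0.
Proof. by rewrite /nowhere_dense => /closure_id <-. Qed.

Lemma nowhere_dense_sub (R : realType) (A B : set R) :
  A `<=` B -> nowhere_dense B -> nowhere_dense A.
Proof.
rewrite /nowhere_dense -!subset0 => AB; apply: subset_trans.
exact/interiorS/closureS.
Qed.

(** Inside any ball, removing [closure A] leaves a nonempty open set, which [closure B] cannot
    contain. *)
Lemma nowhere_denseU (R : realType) (A B : set R) :
  nowhere_dense A -> nowhere_dense B -> nowhere_dense (A `|` B).
Proof.
rewrite /nowhere_dense closureU => A0 B0.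
apply/interior_eq0P => x r r0 xAB.
have oU : open (ball x r `&` ~` closure A).
  by apply: openI; [exact: ball_open|exact/closed_openC/closed_closure].
have [y [xy nAy]] : exists y, ball x r y /\ ~ closure A y.
  apply: contrapT => nex; move/interior_eq0P: A0 => /(_ x r r0); apply => y xy.
  by apply: contrapT => nAy; apply: nex; exists y.
have : (closure B)° y.
  apply: interiorS (_ : (ball x r `&` ~` closure A) `<=` _) _ _.
    by move=> z [/xAB[]].
  by move: oU; rewrite openE; exact.
by rewrite B0.
Qed.

Lemma nowhere_dense_translate (R : realType) (c : R) (A : set R) :
  closed A -> nowhere_dense A -> nowhere_dense [set c + a | a in A].
Proof.
move=> Acl /(nowhere_denseP Acl)/interior_eq0P A0.
have -> : [set c + a | a in A] = (fun x => x - c) @^-1` A.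
  apply/seteqP; split=> [_ [a Aa <-]|x /= Ax].
    by rewrite /= addrAC subrr add0r.
  by exists (x - c) => //; rewrite addrCA subrr addr0.
have cl : closed ((fun x => x - c) @^-1` A).
  by apply: preimage_closed => // x _; apply: cvgB; [exact: cvg_id|exact: cvg_cst].
apply/(nowhere_denseP cl)/interior_eq0P => x r r0 xA.
apply: (A0 (x - c) r r0) => y xy.
have := xA (y + c); rewrite /= addrK; apply.
by move: xy; rewrite -ball_normE /= opprD addrA addrAC.
Qed.

Lemma bigcup_interior0 (R : realType) (F : nat -> set R) :
  (forall n, closed (F n)) -> (forall n, (F n)° = set0) ->
  (\bigcup_n F n)° = set0.
Proof.
move=> Fcl F0; apply/interior_eq0P => x r r0 xF.
have /Baire/(_ (ball x r)) : forall n, open (~` F n) /\ dense (~` F n).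
  move=> n; split; first exact/closed_openC.
  move=> U [y Uy] oU; apply: contrapT => nU.
  have : (F n)° y.
    apply: interiorS (_ : U `<=` _) _ _ => [z Uz|].
      by apply: contrapT => nF; apply: nU; exists z.
    by move: oU; rewrite openE; exact.
  by rewrite F0.
case; [by exists x; exact: ballxx|exact: ball_open|].
by move=> y [/xF[n _ Fy] /(_ n I)].
Qed.

Lemma countable_interior0 (R : realType) (A : set R) :
  countable A -> A° = set0.
Proof.
move=> /pfcard_geP[->|[f]]; first by rewrite interior0.
have fA : A `<=` \bigcup_n [set f n].
  by move=> x Ax; have [n _ <-] := 'surj_f Ax; exists n.
rewrite -subset0; apply: subset_trans (interiorS fA) _; rewrite subset0.
apply: bigcup_interior0 => n.
  by apply: accessible_closed_set1; exact/hausdorff_accessible/Rhausdorff.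
apply/interior_eq0P => x r r0 xfn.
have e1 : x = f n by apply: xfn; exact: ballxx.
have e2 : x + r / 2 = f n.
  by apply: xfn; rewrite -ball_normE /= opprD addNKr normrN gtr0_norm; lra.
lra.
Qed.

(** * Rational linear combinations of elements of a set *)

(** This is the image of a cartesian power of [A] under the linear form with coefficient list [c];
    recursion on [c] replaces row vectors. *)
Fixpoint sumset (R : realType) (A : set R) (c : seq rat) : set R :=
  if c is q :: c' then
    [set x | exists a d, [/\ A a, sumset A c' d & x = ratr q * a + d]]
  else [set 0].

Lemma sumset_cat (R : realType) (A : set R) (c1 c2 : seq rat) (x y : R) :
  sumset A c1 x -> sumset A c2 y -> sumset A (c1 ++ c2) (x + y).
Proof.
elim: c1 x => [|q c1 IH] x /= => [->|[a [d [Aa c1d ->]]] c2y].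
  by rewrite add0r.
by exists a, (d + y); split; [|exact: IH|rewrite addrA].
Qed.

Lemma sumset_scale (R : realType) (A : set R) (k : rat) (c : seq rat) (x : R) :
  sumset A c x -> sumset A (map ( *%R k) c) (ratr k * x).
Proof.
elim: c x => [|q c IH] x /= => [->|[a [d [Aa cd ->]]]]; first by rewrite mulr0.
by exists a, (ratr k * d); split; [|exact: IH|rewrite rmorphM mulrDr mulrA].
Qed.

Lemma sumset_subtract (R : realType) (A : set R) (c1 c2 : seq rat) (x y : R) :
  sumset A c1 x -> sumset A c2 y ->
  sumset A (c1 ++ map ( *%R (-1)) c2) (x - y).
Proof.
move=> xc /(sumset_scale (-1)); rewrite rmorphN1 mulN1r; exact: sumset_cat.
Qed.

Lemma compact_sumset (R : realType) (A : set R) (c : seq rat) :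
  compact A -> compact (sumset A c).
Proof.
move=> Ac; elim: c => [|q c IH] /=; first exact: compact_set1.
pose f (z : R * R) : R := ratr q * z.1 + z.2.
suff -> : [set x | exists a d, [/\ A a, sumset A c d & x = ratr q * a + d]]
    = f @` (A `*` sumset A c).
  apply: continuous_compact; last exact: compact_setX.
  apply: continuous_subspaceT => z; apply: cvgD; last exact: cvg_snd.
  by apply: cvgM; [exact: cvg_cst|exact: cvg_fst].
apply/seteqP; split=> [x [a [d [Aa cd ->]]]|_ [[a d] [Aa cd] <-]].
  by exists (a, d).
by exists a, d.
Qed.

Lemma closed_sumset (R : realType) (A : set R) (c : seq rat) :
  compact A -> closed (sumset A c).
Proof.
by move=> Ac; apply: compact_closed; [exact: Rhausdorff|exact: compact_sumset].
Qed.

Lemma sumsetP (R : realType) (A : set R) (c : seq rat) (x : R) :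
  sumset A c x <->
  exists a : nat -> R, (forall i, (i < size c)%N -> A (a i)) /\
    x = \sum_(i < size c) ratr (nth 0 c i) * a i.
Proof.
elim: c x => [|q c IH] x /=.
  by split=> [->|[a [_ ->]]]; [exists (fun=> 0); split=> //|]; rewrite big_ord0.
split=> [[a [d [Aa /IH[b [Ab ->]] ->]]]|[a [Aa ->]]].
  exists (fun i => if i is j.+1 then b j else a); split=> [[|i] //|].
    exact: Ab.
  by rewrite big_ord_recl.
exists (a 0%N), (\sum_(i < size c) ratr (nth 0 c i) * a i.+1); split.
- exact: Aa.
- by apply/IH; exists (fun i => a i.+1); split=> // i ic; exact: Aa.
- by rewrite big_ord_recl.
Qed.

Lemma image_cartesian_power (R : realType) (E : set R) (n : nat)
    (T : 'rV[R]_n -> R) (q : 'I_n -> rat) :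
  (forall x, T x = \sum_(i < n) ratr (q i) * x 0 i) ->
  T @` cartesian_power E n = sumset E (map q (enum 'I_n)).
Proof.
move=> TE.
have sz : size (map q (enum 'I_n)) = n by rewrite size_map size_enum_ord.
have qE (i : 'I_n) : nth 0 (map q (enum 'I_n)) i = q i.
  by rewrite (nth_map i) ?size_enum_ord // nth_ord_enum.
apply/seteqP; split=> [_ [x Ex <-]|y /sumsetP[a [Ea ->]]].
  apply/sumsetP; rewrite sz.
  exists (fun i => if insub i is Some j then x 0 j else 0); split=> [i lt_in|].
    by rewrite insubT; exact: Ex.
  by rewrite TE; apply: eq_bigr => i _; rewrite qE valK.
rewrite sz in Ea *.
exists (\row_i a i); first by move=> i; rewrite mxE; exact: Ea.
by rewrite TE; apply: eq_bigr => i _; rewrite mxE qE.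
Qed.

Lemma nowhere_dense_Q_linearP (R : realType) (E : set R) :
  (forall (n : nat) (T : 'rV[R]_n -> R), Q_linear T ->
     nowhere_dense (T @` cartesian_power E n)) <->
  forall c : seq rat, nowhere_dense (sumset E c).
Proof.
split=> [H c|H n T [q TE]]; last by rewrite (image_cartesian_power E TE).
pose q (i : 'I_(size c)) := nth 0 c i.
pose T (x : 'rV[R]_(size c)) := \sum_(i < size c) ratr (q i) * x 0 i.
have /H : Q_linear T by exists q.
rewrite (@image_cartesian_power _ _ _ _ q) // (_ : map q _ = c) //.
apply: (@eq_from_nth _ 0) => [|i]; rewrite size_map size_enum_ord // => lt_ic.
rewrite (nth_map (Ordinal lt_ic)) ?size_enum_ord //.
by rewrite (nth_ord_enum _ (Ordinal lt_ic)).
Qed.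

(** * Signed sums and the generated subgroup *)

Definition signs (b : seq bool) : seq rat := [seq (if s then 1 else -1) | s <- b].

(** The signed sums form a subgroup containing [E], so minimality applies. *)
Lemma generated_subgroup_sub (R : realType) (E : set R) :
  generated_subgroup E `<=` \bigcup_(b : seq bool) sumset E (signs b).
Proof.
move=> x /(_ (\bigcup_(b : seq bool) sumset E (signs b))); apply; split.
  split=> [|u v]; first by rewrite in_setE; exists [::].
  rewrite !in_setE => -[b1 _ u1] [b2 _ u2].
  exists (b1 ++ map negb b2) => //.
  rewrite /signs map_cat -map_comp.
  have := sumset_subtract u1 u2; rewrite /signs -map_comp.
  by congr (sumset _ (_ ++ _) _); apply: eq_map => -[] /=; rewrite ?mulN1r ?opprK.
move=> a Ea; exists [:: true] => //=; exists a, 0; split=> //.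
by rewrite rmorph1 mul1r addr0.
Qed.

(** Clearing denominators: [N] is the product of the denominators of the entries of [c]. *)
Lemma subgroup_sumset (R : realType) (H : set R) (c : seq rat) :
  H 0 -> (forall u v, H u -> H v -> H (u - v)) ->
  exists2 N : nat, (0 < N)%N & forall x, sumset H c x -> H (N%:R * x).
Proof.
move=> H0 HB.
have HN u : H u -> H (- u) by move=> Hu; rewrite -sub0r; exact: HB.
have HD u v : H u -> H v -> H (u + v).
  by move=> Hu /HN Hv; rewrite -[v]opprK; exact: HB.
have HMn u n : H u -> H (n%:R * u).
  move=> Hu; elim: n => [|n IH]; first by rewrite mul0r.
  by rewrite -natr1 mulrDl mul1r; exact: HD.
have HMz u (z : int) : H u -> H (z%:~R * u).
  case: z => n Hu; first exact: HMn.
  by rewrite NegzE mulrNz mulNr; apply/HN/HMn.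
elim: c => [|q c [N N0 IH]] /=.
  by exists 1%N => // x ->; rewrite mulr0.
exists (N * `|denq q|)%N; first by rewrite muln_gt0 N0 absz_gt0 denq_neq0.
move=> _ [a [d [Ha /IH Hd ->]]].
have dE : (`|denq q|%N)%:R = (denq q)%:~R :> R.
  by rewrite -[in RHS](gtz0_abs (denq_gt0 q)).
have qE : ratr q = (numq q)%:~R / (denq q)%:~R :> R by [].
have d0 : (denq q)%:~R != 0 :> R by rewrite intr_eq0 denq_neq0.
rewrite natrM dE qE.
have -> : N%:R * (denq q)%:~R * ((numq q)%:~R / (denq q)%:~R * a + d) =
    N%:R * ((numq q)%:~R * a) + (denq q)%:~R * (N%:R * d) by field.
by apply: HD; [exact/HMn/HMz|exact: HMz].
Qed.

(** Any subgroup [H] containing [E] contains an integer multiple of an interval. Differences of its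
    points put all small reals into [H], and every real is an integer multiple of a small one. *)
Lemma generated_subgroup_interior (R : realType) (E : set R) (c : seq rat) :
  (sumset E c)° !=set0 -> generated_subgroup E = setT.
Proof.
move=> [x /nbhs_ballP[r /= r0 xc]]; apply/seteqP; split=> // y _ H [[H0 HB] EH].
have {}H0 : H 0 by move: H0; rewrite in_setE.
have {}HB u v : H u -> H v -> H (u - v).
  by move=> Hu Hv; have := HB u v; rewrite !in_setE; exact.
have HD u v : H u -> H v -> H (u + v).
  by move=> Hu Hv; rewrite -[v]opprK -[- v]sub0r; apply/HB/HB.
have [N N0 HN] := subgroup_sumset c H0 HB.
have HE z : sumset E c z -> H (N%:R * z).
  move=> /sumsetP[a [Ea ->]]; apply: HN; apply/sumsetP; exists a; split=> //.
  by move=> i /Ea/EH.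
have Nr : 0 < N%:R :> R by rewrite ltr0n.
(* This [k] makes [y / N / k] a displacement shorter than [r]; scaling by [N] then leaves [y / k] in
   [H]. *)
pose k := (Num.truncn (`|y / N%:R| / r)).+1.
have k0 : 0 < k%:R :> R by rewrite ltr0n.
have kr : `|y / N%:R / k%:R| < r.
  rewrite normrM [X in _ * X]gtr0_norm ?invr_gt0 // ltr_pdivrMr // [r * _]mulrC.
  rewrite -ltr_pdivrMr //; exact: truncnS_gt.
have /HE Hz : sumset E c (x + y / N%:R / k%:R).
  by apply: xc; rewrite -ball_normE /= opprD addNKr normrN.
have /HE Hx : sumset E c x by apply: xc; exact: ballxx.
have {Hz Hx} Hyk : H (y / k%:R).
  have := HB _ _ Hz Hx; rewrite mulrDr addrAC subrr add0r.
  by congr H; field; rewrite !gt_eqF.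
have -> : y = k%:R * (y / k%:R) by field; rewrite gt_eqF.
elim: (k in k%:R * _) => [|n IH]; first by rewrite mul0r.
by rewrite -natr1 mulrDl mul1r; exact: HD.
Qed.

Lemma generated_subgroup_Baire (R : realType) (E : set R) :
  compact E -> generated_subgroup E = setT ->
  exists b : seq bool, (sumset E (signs b))° !=set0.
Proof.
move=> Ec EE; apply: contrapT => nex.
have b0 b : (sumset E (signs b))° = set0.
  by apply: contrapT => nb; apply: nex; exists b; exact/set0P/eqP.
(* Sign lists are countable: their codes index them, and numbers that code no list get the empty
   set. *)
pose F n := if @unpickle (seq bool) n is Some b then sumset E (signs b) else set0.
have Fcl n : closed (F n).
  by rewrite /F; case: unpickle => [b|]; [exact: closed_sumset|exact: closed0].
have F0 n : (F n)° = set0.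
  by rewrite /F; case: unpickle => [b|]; [exact: b0|exact: interior0].
suff FT : \bigcup_n F n = setT.
  by have := bigcup_interior0 Fcl F0; rewrite FT interiorT => /seteqP[/(_ 0 I)].
apply/seteqP; split=> // x _.
have /generated_subgroup_sub[b _ xb] : generated_subgroup E x by rewrite EE.
by exists (pickle b) => //; rewrite /F pickleK.
Qed.

(** * Sign patterns of affine forms determine the truth of formulas *)

Lemma compact_max (R : realType) (K : set R) :
  compact K -> K !=set0 -> exists2 m, K m & forall x, K x -> x <= m.
Proof.
move=> Kc K0.
have idc : {within K, continuous (@id R)}.
  by apply: continuous_subspaceT => x; exact: cvg_id.
have [c cK cmax] := @compact_EVT_max _ _ (@id R) _ K0 Kc idc.
by exists c => [|x Kx]; [rewrite inE in cK|apply: cmax; rewrite inE].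
Qed.

Lemma compact_min (R : realType) (K : set R) :
  compact K -> K !=set0 -> exists2 m, K m & forall x, K x -> m <= x.
Proof.
move=> Kc K0.
have idc : {within K, continuous (@id R)}.
  by apply: continuous_subspaceT => x; exact: cvg_id.
have [c cK cmin] := @compact_EVT_min _ _ (@id R) _ K0 Kc idc.
by exists c => [|x Kx]; [rewrite inE in cK|apply: cmin; rewrite inE].
Qed.

(* Compactness of the cut points provides the two neighbours of [y] among them;
   any point between their images realises the image of the cut of [y]. *)
Lemma cut_extension (R : realType) (I : Type) (A : set I) (u v : I -> R) (y : R) :
  compact (u @` A) ->
  (forall i j, A i -> A j -> Num.sg (u i - u j) = Num.sg (v i - v j)) ->
  exists z, forall i, A i -> Num.sg (y - u i) = Num.sg (z - v i).
Proof.
move=> Kc uv.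
(* A [y] that is itself a cut point is matched by its image. *)
have [[i Ai <-]|ny] := pselect (exists2 i, A i & u i = y).
  by exists (v i) => j Aj; exact: uv.
have uv_lt i j : A i -> A j -> u i < u j -> v i < v j.
  move=> Ai Aj; rewrite -subr_gt0 -sgr_cp0 uv // sgr_cp0 subr_gt0; exact.
have uv_le i j : A i -> A j -> u i <= u j -> v i <= v j.
  move=> Ai Aj; rewrite -subr_ge0 -sgr_ge0 uv // sgr_ge0 subr_ge0; exact.
suff [z zl zr] : exists2 z, forall i, A i -> u i < y -> v i < z &
    forall i, A i -> y < u i -> z < v i.
  exists z => i Ai; have [iy|iy|iy] := ltgtP (u i) y.
  - by rewrite !gtr0_sg ?subr_gt0 // zl.
  - by rewrite !ltr0_sg ?subr_lt0 // zr.
  - by case: ny; exists i.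
have lo : (forall i, A i -> y < u i) \/ exists p, [/\ A p, u p < y &
    forall i, A i -> u i < y -> u i <= u p].
  have [[i Ai iy]|ni] := pselect (exists2 i, A i & u i < y).
    right; have [|_ [[p Ap <-] /= py] pmax] :=
        compact_max (compact_closedI Kc (@closed_le _ y)).
      by exists (u i); split; [exists i|rewrite /= ltW].
    exists p; split=> // [|j Aj jy].
      by move: py; rewrite le_eqVlt => /orP[/eqP py|//]; case: ny; exists p.
    by apply: pmax; split; [exists j|rewrite /= ltW].
  left=> i Ai; rewrite ltNge le_eqVlt; apply/negP => /orP[/eqP iy|iy].
    by apply: ny; exists i.
  by apply: ni; exists i.
have hi : (forall i, A i -> u i < y) \/ exists p, [/\ A p, y < u p &
    forall i, A i -> y < u i -> u p <= u i].
  have [[i Ai iy]|ni] := pselect (exists2 i, A i & y < u i).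
    right; have [|_ [[p Ap <-] /= py] pmin] :=
        compact_min (compact_closedI Kc (@closed_ge _ y)).
      by exists (u i); split; [exists i|rewrite /= ltW].
    exists p; split=> // [|j Aj jy].
      move: py; rewrite le_eqVlt => /orP[/eqP py|//].
      by case: ny; exists p.
    by apply: pmin; split; [exists j|rewrite /= ltW].
  left=> i Ai; rewrite ltNge le_eqVlt; apply/negP => /orP[/eqP iy|iy].
    by apply: ny; exists i.
  by apply: ni; exists i.
(* With no cut points any [z] works; with a neighbour on one side only, go 1 past its image; with
   two, take the midpoint of their images. *)
case: lo hi => [lo|[p [Ap py pmax]]] [hi|[q [Aq qy qmin]]].
- exists 0 => i Ai iy; first by have := lt_trans iy (lo i Ai); rewrite ltxx.
  by have := lt_trans iy (hi i Ai); rewrite ltxx.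
- exists (v q - 1) => i Ai iy; first by have := lt_trans iy (lo i Ai); rewrite ltxx.
  have := uv_le _ _ Aq Ai (qmin i Ai iy); lra.
- exists (v p + 1) => i Ai iy.
    have := uv_le _ _ Ai Ap (pmax i Ai iy); lra.
  by have := lt_trans iy (hi i Ai); rewrite ltxx.
- have pq := uv_lt _ _ Ap Aq (lt_trans py qy).
  exists ((v p + v q) / 2) => i Ai iy.
    have := uv_le _ _ Ai Ap (pmax i Ai iy); lra.
  have := uv_le _ _ Aq Ai (qmin i Ai iy); lra.
Qed.

(** Coefficients are indexed by de Bruijn variables, those past the end of the list being zero.
    Parameters are variables too, so terms have no constant part. *)
Fixpoint lform (R : realType) (e : nat -> R) (l : seq rat) : R :=
  if l is q :: l' then ratr q * e 0%N + lform (fun i => e i.+1) l' else 0.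

Fixpoint addl (l m : seq rat) : seq rat :=
  match l, m with
  | [::], _ => m
  | _, [::] => l
  | p :: l', q :: m' => p + q :: addl l' m'
  end.

Lemma lform_addl (R : realType) (e : nat -> R) (l m : seq rat) :
  lform e (addl l m) = lform e l + lform e m.
Proof.
elim: l m e => [|p l IH] [|q m] e /=; rewrite ?add0r ?addr0 //.
by rewrite IH rmorphD mulrDl addrACA.
Qed.

Lemma lform_scale (R : realType) (e : nat -> R) (k : rat) (l : seq rat) :
  lform e (map ( *%R k) l) = ratr k * lform e l.
Proof.
elim: l e => [|q l IH] e /=; first by rewrite mulr0.
by rewrite IH rmorphM mulrDr mulrA.
Qed.

Fixpoint term_form (t : term) : seq rat :=
  match t with
  | Var i => rcons (nseq i 0) 1
  | Add t1 t2 => addl (term_form t1) (term_form t2)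
  end.

Lemma eval_term_form (R : realType) (e : nat -> R) (t : term) :
  Defs.eval e t = lform e (term_form t).
Proof.
elim: t => [i|t1 IH1 t2 IH2] /=; last by rewrite lform_addl IH1 IH2.
elim: i e => [|i IH] e /=; first by rewrite rmorph1 mul1r addr0.
by rewrite rmorph0 mul0r add0r -IH.
Qed.

(* A pair [(l, c)] stands for the affine forms [lform _ l + d] with [d] in
   [sumset E c]; [e] and [e'] agree when corresponding forms have equal signs. *)
Definition agree (R : realType) (E : set R) (K : seq (seq rat * seq rat))
    (e e' : nat -> R) : Prop :=
  forall k, k \in K -> forall d, sumset E k.2 d ->
    Num.sg (lform e k.1 + d) = Num.sg (lform e' k.1 + d).

Lemma agree_sym (R : realType) (E : set R) K (e e' : nat -> R) :
  agree E K e e' -> agree E K e' e.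
Proof. by move=> H k kK d kd; rewrite (H k kK d kd). Qed.

Lemma agree_cat (R : realType) (E : set R) K1 K2 (e e' : nat -> R) :
  agree E (K1 ++ K2) e e' -> agree E K1 e e' /\ agree E K2 e e'.
Proof. by move=> H; split=> k kK; apply: H; rewrite mem_cat kK ?orbT. Qed.

(** Applied to two families of cut points, it represents their differences, whose signs give the
    relative order of the cut points. *)
Definition form_sub (k k' : seq rat * seq rat) : seq rat * seq rat :=
  (addl k.1 (map ( *%R (-1)) k'.1), k.2 ++ map ( *%R (-1)) k'.2).

(* Solves the forms of [k] for the variable 0; when 0 does not occur in [k] the
   result is a harmless junk form. *)
Definition cut_form (k : seq rat * seq rat) : seq rat * seq rat :=
  if k.1 is q :: l then (map ( *%R (- q^-1)) l, map ( *%R (- q^-1)) k.2)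
  else ([::], [::]).

(** The first part fixes the mutual order of all cut points for variable 0; the second serves the
    forms in which variable 0 has coefficient zero. *)
Definition project_forms (K : seq (seq rat * seq rat)) :=
  [seq form_sub k k' | k <- map cut_form K, k' <- map cut_form K] ++
  [seq (behead k.1, k.2) | k <- K].

Lemma compact_form_values (R : realType) (E : set R) (e : nat -> R)
    (C : seq (seq rat * seq rat)) :
  compact E ->
  compact ((fun kd : _ * R => lform e kd.1.1 + kd.2) @`
             [set kd | kd.1 \in C /\ sumset E kd.1.2 kd.2]).
Proof.
move=> Ec; elim: C => [|k C IH].
  rewrite (_ : [set _ | _] = set0) ?image_set0; first exact: compact0.
  by apply/seteqP; split=> // ? [].
have -> : [set kd : _ * R | kd.1 \in k :: C /\ sumset E kd.1.2 kd.2] =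
    (pair k) @` sumset E k.2 `|` [set kd | kd.1 \in C /\ sumset E kd.1.2 kd.2].
  apply/seteqP; split=> [[k' d] [/=]|[k' d] [[d' kd'] [<- <-]|[/= k'C k'd]]].
  - by rewrite inE => /orP[/eqP ->|k'C] k'd; [left; exists d|right].
  - by rewrite /= inE eqxx.
  - by rewrite /= inE k'C orbT.
rewrite image_setU; apply: compactU => //; rewrite image_comp.
apply: continuous_compact; last exact: compact_sumset.
by apply: continuous_subspaceT => x; apply: cvgD; [exact: cvg_cst|exact: cvg_id].
Qed.

(** The back-and-forth step: by hypothesis the cut points at [e] and at [e'] are identically
    ordered, so [cut_extension] provides [z]. *)
Lemma agree_extend (R : realType) (E : set R) K (e e' : nat -> R) (y : R) :
  compact E -> agree E (project_forms K) e e' ->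
  exists z, agree E K (env_cons y e) (env_cons z e').
Proof.
move=> Ec /agree_cat[Hsub Htail].
have [i j|z Hz] := @cut_extension _ _ _ _ (fun kd => lform e' kd.1.1 + kd.2) y
  (compact_form_values (e := e) (C := map cut_form K) Ec).
  case: i j => [k d] [k' d'] /= [kC kd] [k'C kd'].
  have := Hsub (form_sub k k') (allpairs_f _ kC k'C) _ (sumset_subtract kd kd').
  rewrite /= !lform_addl !lform_scale rmorphN1 !mulN1r.
  by rewrite ![_ - _ + (d - d')]addrACA -!opprD.
exists z => k kK d kd.
have := Hz (cut_form k, ratr (- (head 0 k.1)^-1) * d).
have := Htail (behead k.1, k.2) (map_f _ kK) d kd.
have := map_f cut_form kK.
case: k {kK} kd => [[|q l] c] //= kd kC Ht Hc.
have [q0|q0] := eqVneq q 0; first by rewrite q0 rmorph0 !mul0r !add0r.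
have {}Hc := Hc (conj kC (sumset_scale _ kd)).
have qr : ratr q != 0 :> R by rewrite fmorph_eq0.
rewrite /= !lform_scale in Hc.
(* Factoring out the leading coefficient turns the sign of a form into the position of variable 0
   relative to its cut point. *)
have E1 (w b : R) : ratr q * w + b + d =
   ratr q * (w - (ratr (- q^-1) * b + ratr (- q^-1) * d)).
  by rewrite rmorphN fmorphV; field.
by rewrite !E1 !sgrM Hc.
Qed.

(** Induction on the formula; a quantifier is handled by projecting the forms needed for its
    body. *)
Lemma agree_holds (R : realType) (E : set R)
    (f : formula (@arity R (expand_by E))) :
  compact E -> exists K, forall e e', agree E K e e' ->
    (holds (M := expand_by E) e f <-> holds (M := expand_by E) e' f).
Proof.
move=> Ec.
elim: f => [t1 t2|t1 t2|s t|g [K HK]|g [K HK] h [L HL]|g [K HK]].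
- exists [:: (addl (term_form t1) (map ( *%R (-1)) (term_form t2)), [::])].
  move=> e e' /(_ _ (mem_head _ _) 0 erefl) /=.
  rewrite !lform_addl !lform_scale rmorphN1 !mulN1r !addr0 -!eval_term_form => H.
  split=> /eqP; rewrite -subr_eq0 -sgr_eq0; [rewrite H|rewrite -H];
    by rewrite sgr_eq0 subr_eq0 => /eqP.
- exists [:: (addl (term_form t1) (map ( *%R (-1)) (term_form t2)), [::])].
  move=> e e' /(_ _ (mem_head _ _) 0 erefl) /=.
  rewrite !lform_addl !lform_scale rmorphN1 !mulN1r !addr0 -!eval_term_form => H.
  by split; rewrite -subr_lt0 -sgr_lt0; [rewrite H|rewrite -H];
    rewrite sgr_lt0 subr_lt0.
- exists [:: (term_form (t ord0), [:: -1])] => e e' H.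
  suff {e e' H} Himp e e' : agree E [:: (term_form (t ord0), [:: -1])] e e' ->
      holds (M := expand_by E) e (Rel t) -> holds (M := expand_by E) e' (Rel t).
    by split; apply: Himp => //; exact: agree_sym.
  move=> H /=; rewrite !mxE => Ee.
  (* For [[:: -1]] the constants [d] are the negatives of elements of [E]. The one that makes the
     form vanish at [e] forces the same value of the term at [e']. *)
  have := H _ (mem_head _ _) (- Defs.eval e (t ord0)).
  rewrite /= -!eval_term_form subrr sgr0 => H'.
  suff /eqP : Defs.eval e' (t ord0) - Defs.eval e (t ord0) == 0.
    by move/eqP; rewrite subr_eq0 => /eqP ->.
  rewrite -sgr_eq0 -H' //; exists (Defs.eval e (t ord0)), 0; split=> //.
  by rewrite rmorphN1 mulN1r addr0.
- by exists K => e e' /HK /= H; rewrite H.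
- by exists (K ++ L) => e e' /agree_cat[/HK H1 /HL H2] /=; rewrite H1 H2.
- exists (project_forms K) => e e' H.
  suff {e e' H} Himp e e' : agree E (project_forms K) e e' ->
      holds (M := expand_by E) e (Ex g) -> holds (M := expand_by E) e' (Ex g).
    by split; apply: Himp => //; exact: agree_sym.
  move=> H [y gy]; have [z /HK Hz] := agree_extend y Ec H.
  by exists z; apply/Hz.
Qed.

(** * Definable subsets of the line *)

Lemma env_cat1 (R : realType) (x : 'rV[R]_1) (p : nat -> R) :
  env_cat x p = env_cons (x 0 0) p.
Proof.
apply/funext => -[|i]; rewrite /env_cat.
  by rewrite insubT //=; congr (x 0 _); exact: val_inj.
by rewrite insubF //= subn1.
Qed.

Lemma env_cat2 (R : realType) (x : 'rV[R]_2) (p : nat -> R) :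
  env_cat x p = env_cons (x 0 0) (env_cons (x 0 1) p).
Proof.
apply/funext => -[|[|i]]; rewrite /env_cat.
- by rewrite insubT //=; congr (x 0 _); exact: val_inj.
- by rewrite insubT //=; congr (x 0 _); exact: val_inj.
- by rewrite insubF //= subn2.
Qed.

Lemma definable1P (R : realType) (M : expansion R) (X : set R) :
  definable1 M X <-> exists (f : formula (@arity R M)) (p : nat -> R),
    forall a, X a <-> holds (env_cons a p) f.
Proof.
split=> -[f [p H]]; exists f, p.
  move=> a; have /seteqP[H1 H2] := H; split=> Ha.
    by have := H1 (const_mx a); rewrite /= env_cat1 mxE; exact.
  by have := H2 (const_mx a); rewrite /= env_cat1 mxE; exact.
by apply/seteqP; split=> x /=; rewrite env_cat1 => /H.
Qed.

Lemma definable2P (R : realType) (M : expansion R) (L : R -> R -> Prop) :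
  definable2 M L <-> exists (f : formula (@arity R M)) (p : nat -> R),
    forall a b, L a b <-> holds (env_cons a (env_cons b p)) f.
Proof.
split=> -[f [p H]]; exists f, p.
  move=> a b; have /seteqP[H1 H2] := H.
  pose x : 'rV[R]_2 := \row_j (if j == 0 then a else b).
  have {}H1 := H1 x; have {}H2 := H2 x.
  by rewrite /= env_cat2 !mxE /= in H1 H2; split.
by apply/seteqP; split=> x /=; rewrite env_cat2 => /H.
Qed.

Lemma nowhere_dense_form_values (R : realType) (E : set R) (e : nat -> R)
    (C : seq (seq rat * seq rat)) :
  compact E -> (forall c, nowhere_dense (sumset E c)) ->
  nowhere_dense ((fun kd : _ * R => lform e kd.1.1 + kd.2) @`
                   [set kd | kd.1 \in C /\ sumset E kd.1.2 kd.2]).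
Proof.
move=> Ec E0; elim: C => [|k C IH].
  apply: (@nowhere_dense_sub _ _ set0) => [_ [kd []] //|].
  by rewrite /nowhere_dense closure0 interior0.
have := nowhere_denseU
  (nowhere_dense_translate (lform e k.1) (closed_sumset Ec) (E0 k.2)) IH.
apply: nowhere_dense_sub => _ [[k' d] [/=]] + kd <-.
rewrite inE => /orP[/eqP kk|k'C]; [left|right; by exists (k', d)].
by exists d; rewrite -?kk.
Qed.

(** Let [B] be the closed nowhere dense set of cut points at the parameters [p]. Off [B] the truth
    of [f] is locally constant, so a point of [X] outside [B] is interior. *)
Lemma definable_interior_or_nowhere_dense (R : realType) (E X : set R) :
  compact E -> (forall c, nowhere_dense (sumset E c)) ->
  definable1 (expand_by E) X -> X° !=set0 \/ nowhere_dense X.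
Proof.
move=> Ec E0 /definable1P[f [p Xf]].
have [K HK] := agree_holds f Ec.
pose C := map cut_form K.
have /compact_closed - /(_ (@Rhausdorff R)) Bcl :=
  compact_form_values (e := p) (C := C) Ec.
have Bnd := nowhere_dense_form_values p C Ec E0.
set B := (X in closed X) in Bcl Bnd.
have [XB|/existsNP[x /not_implyP[Xx nBx]]] := pselect (X `<=` B).
  by right; exact: nowhere_dense_sub XB Bnd.
left; exists x.
have : nbhs x (~` B) by apply: open_nbhs_nbhs; split=> //; exact: closed_openC.
move=> /nbhs_ballP[r /= r0 xB].
apply/nbhs_ballP; exists r => //= x' xx'.
apply/Xf/(HK (env_cons x p)); last exact/Xf.
move=> [[|q l] c] kK d kd //=.
have [q0|q0] := eqVneq q 0; first by rewrite q0 rmorph0 !mul0r !add0r.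
have qr : ratr q != 0 :> R by rewrite fmorph_eq0.
(* The cut point: the value of variable 0 at which the form vanishes. *)
pose s := ratr (- q^-1) * (lform p l + d).
have Bs : B s.
  exists (cut_form (q :: l, c), ratr (- q^-1) * d) => /=.
    by split; [exact: (map_f cut_form)|exact: sumset_scale].
  by rewrite lform_scale /s mulrDr.
have E1 w : ratr q * w + lform p l + d = ratr q * (w - s).
  by rewrite /s rmorphN fmorphV; field.
rewrite !E1 !sgrM; congr (_ * _).
(* The cut point is at distance at least [r] from [x], so [x] and [x'] lie on the same side of
   it. *)
have xs : ~ ball x r s by move=> /xB.
move: xx' xs; rewrite -ball_normE /= => xx' /negP; rewrite -leNgt => xs.
have := xx'; rewrite ltr_distlC => /andP[h1 h2].
have [sx|sx|sx] := ltgtP s x.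
- rewrite gtr0_norm ?subr_gt0 // in xs.
  by rewrite !gtr0_sg //; lra.
- rewrite ltr0_norm ?subr_lt0 // in xs.
  by rewrite !ltr0_sg //; lra.
- by move: xs; rewrite sx subrr normr0; lra.
Qed.

(** * Orders of type omega *)

(** Finite sets and sets of order type omega are countable, hence without interior, whereas a set
    dense in an interval is not nowhere dense. *)
Lemma type_A_interior_or_nowhere_dense (R : realType) (M : expansion R) :
  (forall X : set R, definable1 M X -> X° !=set0 \/ nowhere_dense X) ->
  type_A M.
Proof.
move=> H [X [Xdef [I [_ Iopen [x Ix] IX]] Xomega]].
have Xcount : countable X.
  case: Xomega => [/finite_set_countable //|[L [_ [_ [u [[_ _ +] _]]]]]].
  move=> /surj_card_ge u_surj; by apply: card_le_trans u_surj _; exact: card_lexx.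
have [[y]|X0] := H X Xdef; first by rewrite countable_interior0.
suff : (closure X)° x by rewrite X0.
apply: (@interiorS _ I) => [y /IX|]; last by move: Iopen; rewrite openE; exact.
by apply: closureS => z [].
Qed.

(** The number of predecessors is an isomorphism onto [nat], with inverse [u]. *)
Lemma order_type_omega_finite_segments (R : realType) (X : set R)
    (L : R -> R -> Prop) :
  infinite_set X -> (forall x y, L x y -> X x /\ X y) ->
  (forall x, ~ L x x) -> (forall x y z, L x y -> L y z -> L x z) ->
  (forall x y, X x -> X y -> [\/ L x y, x = y | L y x]) ->
  (forall y, finite_set [set x | L x y]) -> order_type_omega X L.
Proof.
move=> Xinf LX Lirr Ltr Ltot Lfin; split=> //.
pose rank y := #|` fset_set [set x | L x y]|.
have memL x y : (x \in fset_set [set x | L x y]) <-> L x y.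
  by rewrite in_fset_set // in_setE.
have rank_lt x y : L x y -> (rank x < rank y)%N.
  move=> Lxy; apply: fproper_ltn_card; rewrite fproperE; apply/andP; split.
    by apply/fsubsetP => z /memL Lzx; apply/memL/(Ltr _ _ _ Lzx).
  by apply/negP => /fsubsetP/(_ x (iffRL (memL _ _) Lxy)) /memL /Lirr.
have rankP x y : X x -> X y -> L x y <-> (rank x < rank y)%N.
  move=> Xx Xy; split=> [/rank_lt //|xy].
  case: (Ltot x y Xx Xy) => // [xy'|/rank_lt yx]; first by rewrite xy' ltnn in xy.
  by have := ltn_trans xy yx; rewrite ltnn.
have rank_inj x y : X x -> X y -> rank x = rank y -> x = y.
  by move=> Xx Xy xy; case: (Ltot x y Xx Xy) => // /rank_lt; rewrite xy ltnn.
have rank_ge n : exists2 x, X x & (n <= rank x)%N.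
  apply: contrapT => nex; apply: Xinf.
  have /inj_card_eq/eq_finite_set <- : {in X &, injective rank}.
    by move=> x y /set_mem Xx /set_mem Xy; exact: rank_inj.
  apply: sub_finite_set (finite_II n) => _ [x Xx <-] /=.
  by rewrite ltnNge; apply/negP => nx; apply: nex; exists x.
have rank_surj n : exists x, X x /\ rank x = n.
  (* Take [x] of least rank among the ranks at least [n]. Its predecessors have distinct ranks below
     [n], so its rank is [n]. *)
  pose P m := `[< (n <= m)%N /\ exists2 x, X x & rank x = m >].
  have exP : exists m, P m.
    have [x Xx nx] := rank_ge n; exists (rank x); apply/asboolP.
    by split=> //; exists x.
  case: (ex_minnP exP) => m /asboolP[nm [x Xx xm]] mmin.
  exists x; split=> //; apply/eqP; rewrite eqn_leq xm nm andbT -xm.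
  rewrite /rank -(size_iota 0 n) -(size_map rank).
  apply: uniq_leq_size.
    rewrite map_inj_in_uniq ?fset_uniq // => y z /memL /LX[Xy _] /memL /LX[Xz _].
    exact: rank_inj.
  move=> _ /mapP[y /memL Lyx ->]; rewrite mem_iota add0n /= ltnNge.
  apply/negP => ny.
  have /mmin : P (rank y).
    by apply/asboolP; split=> //; exists y => //; have [] := LX _ _ Lyx.
  by rewrite -xm leqNgt rank_lt.
have [u Hu] := choice rank_surj.
have uX n : X (u n) by have [] := Hu n.
have ru n : rank (u n) = n by have [] := Hu n.
exists u; split; last by move=> m n; rewrite rankP // !ru.
split=> //.
- by move=> m n _ _ /(congr1 rank); rewrite !ru.
- by move=> x Xx; exists (rank x) => //; apply: rank_inj.
Qed.

Definition level_union (R : realType) (Y : R -> set R) : set R :=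
  [set y | exists2 t, 0 < t & Y t y].

(** For [Y] decreasing in [t], points surviving to larger [t] come first and ties are broken by [<].
    Comparing levels directly avoids a supremum and is first-order. *)
Definition level_order (R : realType) (Y : R -> set R) (y y' : R) : Prop :=
  [/\ level_union Y y, level_union Y y' &
      (exists t, [/\ 0 < t, Y t y & ~ Y t y']) \/
      (forall t, 0 < t -> (Y t y <-> Y t y')) /\ y < y'].

(** A predecessor of a point of [Y t] lies in [Y t], so initial segments are finite. *)
Lemma level_order_omega (R : realType) (Y : R -> set R) :
  (forall t t', 0 < t -> t <= t' -> Y t' `<=` Y t) ->
  (forall t, 0 < t -> finite_set (Y t)) ->
  infinite_set (level_union Y) ->
  order_type_omega (level_union Y) (level_order Y).
Proof.
move=> Ydec Yfin Yinf.
have Ynest y y' t : 0 < t -> Y t y' -> level_order Y y y' -> Y t y.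
  move=> t0 Yy' [_ _ [[s [s0 Ysy nYsy']]|[H _]]]; last exact/H.
  have [st|/ltW ts] := leP s t; first by case: nYsy'; exact: Ydec Yy'.
  exact: Ydec Ysy.
apply: order_type_omega_finite_segments => //.
- by move=> x y [].
- by move=> x [_ _ [[t [_ Yx]] //|[_]]]; rewrite ltxx.
- move=> x y z xy yz; have [Xx Xy Hxy] := xy; have [_ Xz Hyz] := yz; split=> //.
  case: Hyz => [[t [t0 Yy nYz]]|[Eyz yz']].
    by left; exists t; split=> //; exact: Ynest xy.
  case: Hxy => [[t [t0 Yx nYy]]|[Exy xy']].
    by left; exists t; split=> //; rewrite -Eyz.
  by right; split; [move=> t t0; rewrite Exy // Eyz|exact: lt_trans yz'].
- move=> x y Xx Xy.
  have [[t [t0 Yx nYy]]|H1] := pselect (exists t, [/\ 0 < t, Y t x & ~ Y t y]).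
    by constructor 1; split=> //; left; exists t.
  have [[t [t0 Yy nYx]]|H2] := pselect (exists t, [/\ 0 < t, Y t y & ~ Y t x]).
    by constructor 3; split=> //; left; exists t.
  have E t : 0 < t -> Y t x <-> Y t y.
    move=> t0; split=> Ht; apply: contrapT => nH; [apply: H1|apply: H2];
    by exists t.
  have [xy|yx|xy] := ltgtP x y.
  - by constructor 1; split=> //; right.
  - by constructor 3; split=> //; right; split=> // t t0; rewrite E.
  - by constructor 2.
- move=> y; have [[t t0 Yy]|nXy] := pselect (level_union Y y).
    by apply: sub_finite_set (Yfin t t0) => x /=; exact: Ynest.
  by apply: (@sub_finite_set _ _ set0) => // x [].
Qed.

(** * Gaps of E *)

Definition right_gap (R : realType) (E : set R) (t : R) : set R :=
  [set a | E a /\ forall s, a < s -> s <= a + t -> ~ E s].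

Lemma right_gap_sub (R : realType) (E : set R) (t t' : R) :
  t <= t' -> right_gap E t' `<=` right_gap E t.
Proof.
move=> tt' a [Ea H]; split=> // s sa /le_trans st; apply: H => //.
by apply: st; rewrite lerD2l.
Qed.

(** Such points are more than [t] apart and [E] is bounded; [g] numbers the cells of length [t],
    injectively on these points. *)
Lemma finite_right_gap (R : realType) (E : set R) (t : R) :
  compact E -> 0 < t -> finite_set (right_gap E t).
Proof.
move=> Ec t0; have [M [_ ME]] := compact_bounded Ec.
have {}ME a : E a -> `|a| <= M + 1 by move=> Ea; apply: ME => //; rewrite ltrDl.
pose g (a : R) := Num.truncn ((a + (M + 1)) / t).
have ge0 a : E a -> 0 <= (a + (M + 1)) / t.
  move=> /ME; rewrite ler_norml => /andP[Ma _].
  by apply: divr_ge0; [lra|exact: ltW].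
have g_lt a b : right_gap E t a -> E b -> a < b -> g a <> g b.
  move=> [Ea aE] Eb ab gab.
  have atb : a + t < b by rewrite ltNge; apply/negP => bat; exact: aE bat Eb.
  have /andP[ha _] := truncn_itv (ge0 a Ea).
  have /andP[_ hb] := truncn_itv (ge0 b Eb).
  rewrite -/(g a) in ha; rewrite -/(g b) -gab -natr1 in hb.
  have : (b + (M + 1)) / t - (a + (M + 1)) / t < 1 by lra.
  by rewrite -mulrBl ltr_pdivrMr // mul1r; lra.
have g_inj : {in right_gap E t &, injective g}.
  move=> a b /set_mem Ga /set_mem Gb gab.
  have [ab|ba|//] := ltgtP a b.
    by case: (g_lt a b Ga (proj1 Gb) ab).
  by case: (g_lt b a Gb (proj1 Ga) ba).
have /eq_finite_set <- := inj_card_eq g_inj.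
apply: (sub_finite_set _ (finite_II (Num.truncn ((M + 1 + (M + 1)) / t)).+1)).
move=> _ [a [Ea _] <-] /=; rewrite ltnS; apply: le_truncn.
rewrite ler_pM2r ?invr_gt0 // lerD2r.
by have := ME a Ea; rewrite ler_norml => /andP[].
Qed.

(** Just above [e] there is a [z] outside [E]; [a] is the largest point of [E] below [z], with gap
    [z - a]. *)
Lemma right_gap_approx (R : realType) (E : set R) (e r : R) :
  compact E -> nowhere_dense E -> E e -> 0 < r ->
  exists t a, [/\ 0 < t, right_gap E t a & `|a - e| < r].
Proof.
move=> Ec End Ee r0.
have Ecl : closed E by apply: compact_closed => //; exact: Rhausdorff.
have [z [ez zr nEz]] : exists z, [/\ e < z, z < e + r & ~ E z].
  apply: contrapT => nex.
  have /(nowhere_denseP Ecl)/interior_eq0P/(_ (e + r / 2) (r / 2)) := End.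
  apply; first lra.
  move=> z; rewrite -ball_normE /= ltr_distlC => /andP[z1 z2].
  by apply: contrapT => nEz; apply: nex; exists z; split=> //; lra.
have [|a [Ea /= az] amax] := compact_max (compact_closedI Ec (@closed_le _ z)).
  by exists e; split=> //=; exact: ltW.
have az' : a < z by rewrite lt_neqAle az andbT; apply/eqP => az'; rewrite az' in Ea.
have ea : e <= a by apply: amax; split=> //=; exact: ltW.
exists (z - a), a; split; [by rewrite subr_gt0| |rewrite ger0_norm; lra].
split=> // s as_ sz Es; have : s <= a by apply: amax; split=> //=; lra.
by rewrite leNgt as_.
Qed.

Lemma sumset_mono (R : realType) (A B : set R) (c : seq rat) :
  A `<=` B -> sumset A c `<=` sumset B c.
Proof.
move=> AB; elim: c => [|q c IH] //= x [a [d [Aa cd ->]]].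
by exists a, d; split; [exact: AB|exact: IH|].
Qed.

Lemma finite_sumset (R : realType) (A : set R) (c : seq rat) :
  finite_set A -> finite_set (sumset A c).
Proof.
move=> Afin; elim: c => [|q c IH] /=; first exact: finite_set1.
apply: sub_finite_set (finite_image2 (fun a d => ratr q * a + d) Afin IH).
by move=> x [a [d [Aa cd ->]]]; exists a => //; exists d.
Qed.

Lemma sumset_right_gap_approx (R : realType) (E : set R) (c : seq rat) (y r : R) :
  compact E -> nowhere_dense E -> sumset E c y -> 0 < r ->
  exists t x, [/\ 0 < t, sumset (right_gap E t) c x & `|x - y| < r].
Proof.
move=> Ec End; elim: c y r => [|q c IH] y r /=.
  by move=> -> r0; exists 1, 0; split=> //; rewrite subrr normr0.
move=> [e [d [Ee cd ->]]] r0.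
have r2 : 0 < r / 2 by lra.
have [t [x [t0 tx xd]]] := IH d (r / 2) cd r2.
(* Adding 1 keeps the divisor positive when [q] is zero. *)
have q1 : 0 < `|ratr q : R| + 1 by rewrite ltr_wpDl.
have [t' [a [t'0 t'a ae]]] := right_gap_approx Ec End Ee (divr_gt0 r2 q1).
(* Lowering the level only adds gap points, so the minimum serves both summands. *)
exists (Num.min t t'), (ratr q * a + x); split; first by rewrite lt_min t0.
  exists a, x; split=> //.
    by apply: right_gap_sub t'a; rewrite ge_min lexx orbT.
  by apply: sumset_mono tx; apply: right_gap_sub; rewrite ge_min lexx.
rewrite opprD addrACA -mulrBr; apply: le_lt_trans (ler_normD _ _) _.
have : `|ratr q * (a - e)| <= r / 2; last by lra.
rewrite normrM; apply: (@le_trans _ _ ((`|ratr q| + 1) * `|a - e|)).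
  by apply: ler_wpM2r => //; rewrite lerDl.
by rewrite mulrC -ler_pdivlMr // ltW.
Qed.

(** * Formulas for the signed sums of gap points and their order *)

Section GapFormulas.
Variables (R : realType) (E : set R).
Notation M := (expand_by E).
Notation F := (formula (@arity R M)).
Implicit Types (e : nat -> R) (b : seq bool).

(* The numeric arguments below are de Bruijn indices of free variables. *)

Definition f_mem (i : nat) : F := @Rel _ (@arity R M) tt (fun=> Var i).

(** The language has no symbol for 0; [x < x + x] expresses positivity. *)
Definition f_pos (i : nat) : F := Lt _ (Var i) (Add (Var i) (Var i)).

Definition f_disj (f g : F) : F := Neg (Conj (Neg f) (Neg g)).

Definition f_gap (t a : nat) : F :=
  Conj (f_mem a) (Neg (Ex (Conj (Lt _ (Var a.+1) (Var 0))
    (Conj (Neg (Lt _ (Add (Var a.+1) (Var t.+1)) (Var 0))) (f_mem 0))))).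

(** Index 0 is the gap point and index 1 the sum of the remaining terms. A negative sign moves the
    point across the equation, and [y + y = y] says that [y] is 0. *)
Fixpoint f_sum (b : seq bool) (t y : nat) : F :=
  if b is s :: b' then
    Ex (Ex (Conj (f_gap t.+2 0) (Conj (f_sum b' t.+2 1)
      (if s then Eq _ (Var y.+2) (Add (Var 0) (Var 1))
       else Eq _ (Add (Var y.+2) (Var 0)) (Var 1)))))
  else Eq _ (Add (Var y) (Var y)) (Var y).

Definition f_union (b : seq bool) (y : nat) : F :=
  Ex (Conj (f_pos 0) (f_sum b 0 y.+1)).

Definition f_separate (b : seq bool) (x y : nat) : F :=
  Ex (Conj (f_pos 0) (Conj (f_sum b 0 x.+1) (Neg (f_sum b 0 y.+1)))).

(** The two negated separations together express that both points have the same levels. *)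
Definition f_order (b : seq bool) : F :=
  Conj (f_union b 0) (Conj (f_union b 1)
    (f_disj (f_separate b 0 1)
      (Conj (Conj (Neg (f_separate b 0 1)) (Neg (f_separate b 1 0)))
        (Lt _ (Var 0) (Var 1))))).

Lemma holds_f_pos e i : holds (M := M) e (f_pos i) <-> 0 < e i.
Proof. by rewrite /= ltrDl. Qed.

Lemma holds_f_disj e (f g : F) :
  holds (M := M) e (f_disj f g) <-> holds (M := M) e f \/ holds (M := M) e g.
Proof. by rewrite /= -not_orE; split=> [/contrapT|H]. Qed.

Lemma holds_f_gap e t a : holds (M := M) e (f_gap t a) <-> right_gap E (e t) (e a).
Proof.
rewrite /f_gap /right_gap /= !mxE /=; split=> -[Ea H]; split=> //.
  move=> s sa st Es; apply: H; exists s; rewrite !mxE /=; split=> //; split=> //.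
  by apply/negP; rewrite -leNgt.
move=> [s [sa []]]; rewrite !mxE /= => /negP; rewrite -leNgt => st Es.
exact: H Es.
Qed.

Lemma holds_f_sum e b t y :
  holds (M := M) e (f_sum b t y) <-> sumset (right_gap E (e t)) (signs b) (e y).
Proof.
elim: b e t y => [|s b IH] e t y.
  by rewrite /=; split=> [|->]; lra.
have sE (x d : R) : let: e' := env_cons x (env_cons d e) in
    holds (M := M) e' (if s then Eq _ (Var y.+2) (Add (Var 0) (Var 1))
                 else Eq _ (Add (Var y.+2) (Var 0)) (Var 1)) <->
    e y = ratr (if s then 1 else -1) * x + d.
  by case: s => /=; rewrite ?rmorphN1 ?rmorph1; split; lra.
split=> [[d [x [/holds_f_gap Hg [/IH Hd /sE Hy]]]]|[x [d [Hg Hd Hy]]]].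
  by exists x, d.
exists d, x; split; first exact/holds_f_gap.
by split; [exact/IH|exact/sE].
Qed.

Let Y b (t : R) := sumset (right_gap E t) (signs b).

Lemma holds_f_union e b y :
  holds (M := M) e (f_union b y) <-> level_union (Y b) (e y).
Proof.
split=> [[t [/holds_f_pos t0 /holds_f_sum Hy]]|[t t0 Hy]]; first by exists t.
by exists t; split; [exact/holds_f_pos|exact/holds_f_sum].
Qed.

Lemma holds_f_separate e b x y :
  holds (M := M) e (f_separate b x y) <->
  exists t, [/\ 0 < t, Y b t (e x) & ~ Y b t (e y)].
Proof.
split=> [[t [/holds_f_pos t0 [/holds_f_sum Hx Hy]]]|[t [t0 Hx Hy]]].
  by exists t; split=> // Hn; apply/Hy/holds_f_sum.
exists t; split; first exact/holds_f_pos.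
by split; [exact/holds_f_sum|move=> /holds_f_sum].
Qed.

Lemma holds_f_order e b :
  holds (M := M) e (f_order b) <-> level_order (Y b) (e 0%N) (e 1%N).
Proof.
have holdsC (f g : F) : holds (M := M) e (Conj f g) <->
  holds (M := M) e f /\ holds (M := M) e g by [].
have holdsN (f : F) : holds (M := M) e (Neg f) <-> ~ holds (M := M) e f by [].
rewrite /f_order !holdsC holds_f_disj !holdsC !holdsN.
rewrite !holds_f_union !holds_f_separate.
split=> [[H0 [H1 H]]|[H0 H1 H]].
  split=> //; case: H => [H|[[nH1 nH2] lt01]]; [by left|right].
  split=> // t t0; split=> Ht; apply: contrapT => nHt; [apply: nH1|apply: nH2];
  by exists t.
split=> //; split=> //; case: H => [H|[H lt01]]; [by left|right].
by split=> //; split=> -[t [t0 Ht nHt]]; exact/nHt/H.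
Qed.

End GapFormulas.

(** * Type A and the generated subgroup; the equivalences *)

Lemma type_A_generated_subgroup (R : realType) (E : set R) :
  compact E -> nowhere_dense E -> type_A (expand_by E) ->
  generated_subgroup E <> setT.
Proof.
move=> Ec End EA /(generated_subgroup_Baire Ec)[b [x /nbhs_ballP[r /= r0 xb]]].
apply: EA; pose Y (t : R) := sumset (right_gap E t) (signs b).
exists (level_union Y); split.
- apply/definable1P; exists (f_union E b 0), (fun=> 0) => a.
  exact: iff_sym (holds_f_union E (env_cons a _) b 0).
- exists (ball x r); split.
  + by rewrite ball_itv; exact: interval_is_interval.
  + exact: ball_open.
  + by exists x; exact: ballxx.
  + move=> y xy B /nbhs_ballP[s /= s0 yB].
    have [s' /= s'0 ys'] : nbhs_ball y (ball x r).
      by apply/nbhs_ballP/open_nbhs_nbhs; split=> //; exact: ball_open.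
    (* The minimum keeps the approximating point both in the given neighbourhood of [y] and in the
       ball around [x]. *)
    have ss0 : 0 < Num.min s s' by rewrite lt_min s0.
    have [t [z [t0 Yz]]] := sumset_right_gap_approx Ec End (xb _ xy) ss0.
    rewrite lt_min distrC => /andP[zs zs']; exists z; split; last first.
      by apply: yB; rewrite -ball_normE.
    by split; [exists t|apply: ys'; rewrite -ball_normE].
- have [Yfin|Yinf] := pselect (finite_set (level_union Y)); [by left|right].
  exists (level_order Y); split.
    apply/definable2P; exists (f_order E b), (fun=> 0) => a a'.
    exact: iff_sym (holds_f_order E (env_cons a (env_cons a' _)) b).
  apply: level_order_omega => //.
    by move=> t t' _ tt'; apply: sumset_mono; exact: right_gap_sub.
  by move=> t t0; apply: finite_sumset; exact: finite_right_gap.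
Qed.

Theorem theorem7p3 (R : realType) (E : set R)
    (E_compact : compact E) (E_nowhere_dense : nowhere_dense E) :
  [<-> type_A (expand_by E);
       forall X : set R, definable1 (expand_by E) X ->
         X° !=set0 \/ nowhere_dense X;
       forall (n : nat) (T : 'rV[R]_n -> R), Q_linear T ->
         nowhere_dense (T @` cartesian_power E n);
       generated_subgroup E <> setT].
Proof.
have A1 : generated_subgroup E <> setT ->
    forall c : seq rat, nowhere_dense (sumset E c).
  move=> EG c; apply/(nowhere_denseP (closed_sumset (c := c) E_compact)).
  by apply: contrapT => /eqP/set0P/generated_subgroup_interior.
have A2 : type_A (expand_by E) -> forall c : seq rat, nowhere_dense (sumset E c).
  by move=> EA; apply/A1/type_A_generated_subgroup.
(* Nowhere density of every [sumset E c] is the hub: each implication first derives it from its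
   hypothesis. *)
tfae.
- by move=> /A2 H X; exact: definable_interior_or_nowhere_dense.
- by move=> /type_A_interior_or_nowhere_dense/A2 H; apply/nowhere_dense_Q_linearP.
- move=> /nowhere_dense_Q_linearP H /(generated_subgroup_Baire E_compact)[b].
  by case=> x; rewrite (iffLR (nowhere_denseP (closed_sumset E_compact)) (H _)).
- move=> /A1 H; apply: type_A_interior_or_nowhere_dense => X.
  exact: definable_interior_or_nowhere_dense.
Qed.
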